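(* Let $n\ge 4$, $1=\mu_1<\mu_2<\dots<\mu_n$, $C=\{(u,v)\in\mathbb{R}^2;\ 0\le v\le u\le \mu_n v\}$, and let $\widehat q_i:C\to[0,\infty)$, $1\le i\le n$, be the functions defined in the context. Then: (1) for every $(u,v)\in C$, the quantity $(1-\mu_i^{-1})\,\widehat q_i(u,v)$ is non-decreasing in $i$ for $2\le i\le n$; (2) for every $2\le i\le n$ and $(u,v)\in C$, $$\widehat q_i(u,v)\le \big[(n-i+1)(1-\mu_i^{-1})\big]^{-1}(u-v).$$
   Context: For $(u,v)$ in the interior $\mathring{C}$ of $C$ consider the compact convex polytope $$\mathbb{V}_{u,v}=\Big\{(s_3,\dots,s_n)\in[0,\infty)^{n-2};\ \sum_{i=3}^n\big(1-\tfrac{\mu_1}{\mu_i}\big)s_i\le u-\mu_1v\ \text{ and }\ \sum_{i=3}^n\big(1-\tfrac{\mu_2}{\mu_i}\big)s_i\ge u-\mu_2v\Big\},$$ which has positive $(n-2)$-dimensional Lebesgue measure. For $3\le i\le n$, $\widehat q_i(u,v)$ is the mean of the coordinate $s_i$ under the normalized Lebesgue measure on $\mathbb{V}_{u,v}$. Then $\widehat q_1(u,v),\widehat q_2(u,v)$ are determined by $\sum_{i=1}^n\widehat q_i(u,v)=u$ and $\sum_{i=1}^n\frac1{\mu_i}\widehat q_i(u,v)=v$. On the boundary of $C$ the functions are defined by (continuous extension) $\widehat q_1(u,u)=u$, $\widehat q_i(u,u)=0$ for $2\le i\le n$, and $\widehat q_n(u,u/\mu_n)=u$, $\widehat q_i(u,u/\mu_n)=0$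 for $1\le i\le n-1$, for all $u\ge0$. *)

(* Defs.v *)
From HB Require Import structures.
From mathcomp Require Import all_boot all_order all_algebra.
From mathcomp Require Import all_classical all_reals all_analysis.
From mathcomp Require Import ring lra.

Set Implicit Arguments.
Unset Strict Implicit.
Unset Printing Implicit Defensive.

Import Order.TTheory GRing.Theory Num.Theory.
Import numFieldNormedType.Exports.

Local Open Scope classical_set_scope.
Local Open Scope ring_scope.

Lemma sigma_finite_product d1 d2 (T1 : measurableType d1)
    (T2 : measurableType d2) (R : realType)
    (m1 : {sigma_finite_measure set T1 -> \bar R})
    (m2 : {sigma_finite_measure set T2 -> \bar R}) :
  sigma_finite setT (m1 \x m2)%E.
Proof.
have /sigma_finiteP[F [TF ndF Foo]] := sigma_finiteT m1.
have /sigma_finiteP[G [TG ndG Goo]] := sigma_finiteT m2.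
exists (fun n => F n `*` G n).
  rewrite -setXTT TF TG predeqE => -[x y]; split.
    move=> [/= [n _ Fnx] [k _ Gky]]; exists (maxn n k) => //; split.
    - by move: x Fnx; exact/subsetPset/ndF/leq_maxl.
    - by move: y Gky; exact/subsetPset/ndG/leq_maxr.
  by move=> [n _ []/= ? ?]; split; exists n.
move=> k; have [? ?] := Foo k; have [? ?] := Goo k.
split; first exact: measurableX.
by rewrite product_measure1E// lte_mul_pinfty// ge0_fin_numE.
Qed.

(* The library has product measures only for two factors, so Lebesgue measure
   on R^d is built as the iterated product measure on d.-tuple R. *)
Section lebesgue_tuple.
Context {R : realType}.

Definition tuple_of_pair d (p : R * d.-tuple R) : d.+1.-tuple R :=
  [tuple of p.1 :: p.2].

Fixpoint lebesgue_tuple (d : nat) : set (d.-tuple R) -> \bar R :=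
  match d with
  | 0 => \d_([tuple] : 0.-tuple R)
  | d'.+1 => pushforward (lebesgue_measure \x @lebesgue_tuple d')%E
               (@tuple_of_pair d')
  end.

Lemma measurable_tuple_of_pair d :
  measurable_fun [set: R * d.-tuple R] (@tuple_of_pair d).
Proof. exact: measurable_cons. Qed.

Definition pair_of_tuple d (t : d.+1.-tuple R) : R * d.-tuple R :=
  (thead t, [tuple of behead t]).

Lemma measurable_pair_of_tuple d :
  measurable_fun [set: d.+1.-tuple R] (@pair_of_tuple d).
Proof.
apply/measurable_fun_pairP; split => /=.
  exact: (@measurable_tnth _ R d.+1 ord0).
exact: measurable_behead.
Qed.

Lemma tuple_of_pairK d : cancel (@tuple_of_pair d) (@pair_of_tuple d).
Proof. by move=> [x t]; congr pair; exact/val_inj. Qed.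

Lemma lebesgue_tuple_measure d :
  {m : {sigma_finite_measure set (d.-tuple R) -> \bar R} |
    @lebesgue_tuple d = m}.
Proof.
elim: d => [|d [m IH]]; first by exists (\d_([tuple] : 0.-tuple R)).
rewrite /= IH.
have mT := @measurable_tuple_of_pair d.
pose P : {measure set _ -> \bar R} :=
  measure_function_pushforward__canonical__measure_function_Measure
    (lebesgue_measure \x m)%E mT.
have sP : sigma_finite setT P.
  have [F FT mF] := sigma_finite_product (@lebesgue_measure R) m.
  exists (fun k => @pair_of_tuple d @^-1` F k).
    by rewrite -preimage_bigcup -FT preimage_setT.
  move=> k; have [mFk Fk] := mF k; split.
    by rewrite -[X in measurable X]setTI; exact: measurable_pair_of_tuple.
  rewrite /P /= /pushforward -comp_preimage.
  rewrite (_ : pair_of_tuple (d:=d) \o tuple_of_pair (d:=d) = id)//.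
  by apply/funext => p; exact: tuple_of_pairK.
pose sfP := @Measure_isSigmaFinite.Build _ _ _ P sP.
pose Q : {sigma_finite_measure set (d.+1.-tuple R) -> \bar R} :=
  HB.pack (P : set _ -> \bar R) (Measure.class P) sfP.
by exists Q.
Qed.

Section instances.
Variable d : nat.

Let lebesgue_tuple0 : @lebesgue_tuple d set0 = 0%E.
Proof. by have [m ->] := lebesgue_tuple_measure d; exact: measure0. Qed.

Let lebesgue_tuple_ge0 A : (0 <= @lebesgue_tuple d A)%E.
Proof. by have [m ->] := lebesgue_tuple_measure d; exact: measure_ge0. Qed.

Let lebesgue_tuple_sigma_additive : semi_sigma_additive (@lebesgue_tuple d).
Proof.
by have [m ->] := lebesgue_tuple_measure d; exact: measure_semi_sigma_additive.
Qed.

HB.instance Definition _ := isMeasure.Build _ _ _ (@lebesgue_tuple d)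
  lebesgue_tuple0 lebesgue_tuple_ge0 lebesgue_tuple_sigma_additive.

Let lebesgue_tuple_sigma_finite : sigma_finite setT (@lebesgue_tuple d).
Proof. by have [m ->] := lebesgue_tuple_measure d; exact: sigma_finiteT. Qed.

HB.instance Definition _ := Measure_isSigmaFinite.Build _ _ _
  (@lebesgue_tuple d) lebesgue_tuple_sigma_finite.

End instances.

End lebesgue_tuple.
Arguments lebesgue_tuple {R} d _.

(* Tuples are 0-based while the coordinates of R^(n-2) are named s_3, ..., s_n,
   hence s`_(i - 3) for s_i below. *)
Section qhat.
Context {R : realType}.
Implicit Types (n i : nat) (mu : nat -> R) (u v : R).

Definition cone n mu : set (R * R) :=
  [set p | [/\ 0 <= p.2, p.2 <= p.1 & p.1 <= mu n * p.2]].

Definition polytope n mu u v : set ((n - 2).-tuple R) :=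
  [set s | [/\ forall i, (3 <= i <= n)%N -> 0 <= s`_(i - 3),
    \sum_(3 <= i < n.+1) (1 - mu 1%N / mu i) * s`_(i - 3) <= u - mu 1%N * v &
    \sum_(3 <= i < n.+1) (1 - mu 2%N / mu i) * s`_(i - 3) >= u - mu 2%N * v]].

Arguments polytope : clear implicits.

Definition lebesgue_mean d (V : set (d.-tuple R)) (f : d.-tuple R -> R) : R :=
  (\int[lebesgue_tuple d]_(s in V) f s) / fine (lebesgue_tuple d V).

Record is_qhat n mu (q : nat -> R -> R -> R) : Prop := IsQhat {
  qhat_mean : forall u v, (cone n mu)^° (u, v) ->
    forall i, (3 <= i <= n)%N ->
    q i u v = lebesgue_mean (polytope n mu u v) (fun s => s`_(i - 3)) ;
  qhat_sum : forall u v, (cone n mu)^° (u, v) ->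
    \sum_(1 <= i < n.+1) q i u v = u ;
  qhat_sumV : forall u v, (cone n mu)^° (u, v) ->
    \sum_(1 <= i < n.+1) (mu i)^-1 * q i u v = v ;
  qhat_diag1 : forall u, 0 <= u -> q 1%N u u = u ;
  qhat_diag0 : forall u, 0 <= u ->
    forall i, (2 <= i <= n)%N -> q i u u = 0 ;
  qhat_last : forall u, 0 <= u -> q n u (u / mu n) = u ;
  qhat_last0 : forall u, 0 <= u ->
    forall i, (1 <= i <= n.-1)%N -> q i u (u / mu n) = 0
}.

Lemma interior_cone n mu u v : 1 < mu n ->
  (cone n mu)^° (u, v) <-> v < u < mu n * v.
Proof.
move=> mun; split.
  rewrite /interior => /nbhs_ballP[e /= e0 eC].
  have He2 : 0 < e / 2 by rewrite divr_gt0.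
  have e2e : e / 2 < e by rewrite ltr_pdivrMr// ltr_pMr// ltr1n.
  have [_ + _] : cone n mu (u, v + e / 2).
    apply: eC; split => /=; first exact: ballxx.
    by rewrite -ball_normE /= opprD addNKr normrN gtr0_norm.
  have [_ _ +] : cone n mu (u, v - e / 2).
    apply: eC; split => /=; first exact: ballxx.
    by rewrite -ball_normE /= subKr gtr0_norm.
  by move=> /= h1 h2; apply/andP; split; nra.
move=> /andP[vu uv].
have c1 : (fun p : R * R => p.1 - p.2) @ nbhs (u, v) --> u - v.
  by apply: cvgB; [exact: cvg_fst|exact: cvg_snd].
have c2 : (fun p : R * R => mu n * p.2 - p.1) @ nbhs (u, v) --> mu n * v - u.
  by apply: cvgB; [apply: cvgM; [exact: cvg_cst|exact: cvg_snd]|exact: cvg_fst].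
have n1 : \forall p \near (u, v), 0 < p.1 - p.2.
  by apply: (cvgr_gt _ c1); rewrite subr_gt0.
have n2 : \forall p \near (u, v), 0 < mu n * p.2 - p.1.
  by apply: (cvgr_gt _ c2); rewrite subr_gt0.
rewrite /interior; near=> p.
have h1 : 0 < p.1 - p.2 by near: p.
have h2 : 0 < mu n * p.2 - p.1 by near: p.
by split; nra.
Unshelve. all: by end_near. Qed.

Lemma is_qhat_exists n mu : (4 <= n)%N -> mu 1%N = 1 ->
  (forall i j, (1 <= i)%N -> (i < j)%N -> (j <= n)%N -> mu i < mu j) ->
  exists q, is_qhat n mu q.
Proof.
move=> n4 mu1 muS.
have mun : 1 < mu n by rewrite -mu1; apply: muS => //; exact: leq_trans n4.
have mu2 : 1 < mu 2%N by rewrite -mu1; apply: muS => //; exact: leq_trans n4.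
pose m i u v := lebesgue_mean (polytope n mu u v) (fun s => s`_(i - 3)).
pose S u v := \sum_(3 <= i < n.+1) m i u v.
pose T u v := \sum_(3 <= i < n.+1) (mu i)^-1 * m i u v.
pose q2 u v := ((u - S u v) - (v - T u v)) / (1 - (mu 2%N)^-1).
pose p i u v := if i == 1%N then u - S u v - q2 u v else
  if i == 2%N then q2 u v else m i u v.
pose q i u v : R := if u == v then (if i == 1%N then u else 0) else
  if u == mu n * v then (if i == n then u else 0) else p i u v.
have qE u v : (cone n mu)^° (u, v) -> forall i, q i u v = p i u v.
  move=> /(interior_cone _ _ mun) /andP[vu uv] i.
  by rewrite /q (gt_eqF vu) (lt_eqF uv).
have split3 (F : nat -> R) : \sum_(1 <= i < n.+1) F i =
    F 1%N + F 2%N + \sum_(3 <= i < n.+1) F i.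
  have n1 : (1 < n.+1)%N by rewrite ltnS (leq_trans _ n4).
  have n2 : (2 < n.+1)%N by rewrite ltnS (leq_trans _ n4).
  by rewrite (big_ltn n1) (big_ltn n2) addrA.
have qn u : 0 <= u -> forall i, q i u (u / mu n) = if i == n then u else 0.
  move=> u0 i; have mun0 : mu n != 0 by rewrite gt_eqF// (lt_trans ltr01).
  have uK : mu n * (u / mu n) = u by rewrite mulrC divfK.
  rewrite /q uK eqxx.
  case: eqP => // uE.
  suff -> : u = 0 by rewrite !if_same.
  have : u * (mu n - 1) = 0.
    by rewrite mulrBr mulr1 mulrC {1}uE uK subrr.
  by move/eqP; rewrite mulf_eq0 subr_eq0 (gt_eqF mun) orbF => /eqP.
exists q; split.
- move=> u v uv i /andP[i3 _]; rewrite qE// /p.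
  by case: i i3 => [|[|[]]].
- move=> u v uv; under eq_bigr do rewrite qE//.
  rewrite split3 /p /= -/(S u v).
  rewrite (_ : \sum_(3 <= i < n.+1) _ = S u v); first by ring.
  by apply: eq_big_nat => -[|[|[]]].
- move=> u v uv; under eq_bigr do rewrite qE//.
  rewrite split3 /p /=.
  rewrite (_ : \sum_(3 <= i < n.+1) _ = T u v); last first.
    by apply: eq_big_nat => -[|[|[]]].
  rewrite mu1 /q2; field.
  by apply/andP; split; lra.
- by move=> u _; rewrite /q !eqxx.
- by move=> u _ [|[|i]]// _; rewrite /q eqxx.
- by move=> u u0; rewrite qn// eqxx.
- move=> u u0 i /andP[i1 iN]; rewrite qn//.
  by case: eqP => // iE; move: iN; rewrite iE; case: (n) n4 => // k; rewrite ltnn.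
Qed.

End qhat.
Arguments polytope {R} n mu u v _.

(* Main.v *)
(* In the weighted coordinates x_i = (1 - 1/mu_i) s_i (3 <= i <= n) and
   x_2 = (u - v) - (x_3 + ... + x_n), the polytope V_{u,v} is the set of x >= 0
   with x_2 + ... + x_n = u - v and x_2/(mu_2 - 1) + ... + x_n/(mu_n - 1) <= v.
   Exchanging x_i and x_j preserves Lebesgue measure. For i < j the weights
   satisfy 1/(mu_i - 1) > 1/(mu_j - 1), so on the part of V_{u,v} where
   x_i > x_j the exchange stays in V_{u,v}; hence E x_i <= E x_j, which is (1).
   As the E x_i are nonnegative with sum u - v, (n - i + 1) E x_i <= u - v,
   which is (2). *)
Require Import Defs.
From mathcomp Require Import all_boot all_order all_algebra fingroup perm.
From mathcomp Require Import all_classical all_reals all_analysis.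
From mathcomp Require Import measurable_realfun.
From mathcomp Require Import ring lra zify.

Set Implicit Arguments.
Unset Strict Implicit.
Unset Printing Implicit Defensive.

Import Order.TTheory GRing.Theory Num.Theory.
Import numFieldNormedType.Exports.

Local Open Scope classical_set_scope.
Local Open Scope ring_scope.

(** * Invariance of Lebesgue measure under reflections along one axis *)

Lemma lebesgue_measure_reflect (R : realType) (c : R) (A : set R) :
  measurable A ->
  lebesgue_measure ((fun x : R => c - x) @^-1` A) = lebesgue_measure A.
Proof.
move=> mA.
have mf : measurable_fun [set: R]
    ((fun x : R => c - x) : _ -> measurableTypeR R).
  exact: measurable_funB.
pose P : {measure set (measurableTypeR R) -> \bar R} :=
  measure_function_pushforward__canonical__measure_function_Measure
    (@lebesgue_measure R) mf.
(* It suffices to compare both measures on the intervals []a, b]]; the preimage of such an interval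
   is [[c - b, c - a[], of the same length. *)
apply/esym/(@lebesgue_measure_unique R P) => //= _ [[a b]] _ <-.
rewrite /P/= /pushforward.
rewrite (_ : _ @^-1` _ = `[c - b, c - a[%classic); last first.
  apply/seteqP; split => x /=; rewrite !in_itv/=.
    by move=> /andP[? ?]; apply/andP; split; lra.
  by move=> /andP[? ?]; apply/andP; split; lra.
rewrite !lebesgue_measure_itv/= !lte_fin.
rewrite ltrD2l ltrN2; case: ifP => // _.
by rewrite -!EFinB; congr EFin; lra.
Qed.

Section reflect_coordinate.
Context {R : realType}.
Implicit Types (d : nat) (c : R).

(** On each line parallel to the [k]-th axis this is a point reflection, whose centre depends
    affinely on the other coordinates. Exchanging two weighted coordinates will take this form. *)
Definition reflect_coord d (k : 'I_d) c (b : 'I_d -> R) (t : d.-tuple R) :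
    d.-tuple R :=
  [tuple if l == k then
     c - \sum_(m | m != k) b m * tnth t m - tnth t k else tnth t l | l < d].

Lemma measurable_linear_comb d (P : pred 'I_d) (b : 'I_d -> R) :
  measurable_fun [set: d.-tuple R] (fun t => \sum_(m | P m) b m * tnth t m).
Proof.
under eq_fun do rewrite big_mkcond/=.
apply: measurable_sum => m; case: (P m); last exact: measurable_cst.
by apply: measurable_funM => //; exact: measurable_tnth.
Qed.

Lemma measurable_reflect_coord d (k : 'I_d) c (b : 'I_d -> R) :
  measurable_fun [set: d.-tuple R] (reflect_coord k c b).
Proof.
apply/measurable_fun_tnthP => l.
have [->|lk] := eqVneq l k; last first.
  rewrite (_ : _ \o _ = fun t => tnth t l); first exact: measurable_tnth.
  by apply/funext => t /=; rewrite tnth_mktuple (negbTE lk).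
rewrite (_ : _ \o _ = fun t => c - \sum_(m | m != k) b m * tnth t m - tnth t k).
  apply: measurable_funB; last exact: measurable_tnth.
  by apply: measurable_funB => //; exact: measurable_linear_comb.
by apply/funext => t /=; rewrite tnth_mktuple eqxx.
Qed.

Lemma tnth_tuple_of_pair0 d (p : R * d.-tuple R) :
  tnth (tuple_of_pair p) ord0 = p.1.
Proof. by []. Qed.

Lemma tnth_tuple_of_pairS d (p : R * d.-tuple R) (l : 'I_d) :
  tnth (tuple_of_pair p) (lift ord0 l) = tnth p.2 l.
Proof. by rewrite tnthS; congr tnth; exact: val_inj. Qed.

Lemma reflect_coord0 d c (b : 'I_d.+1 -> R) (p : R * d.-tuple R) :
  reflect_coord ord0 c b (tuple_of_pair p) =
  tuple_of_pair (c - \sum_l b (lift ord0 l) * tnth p.2 l - p.1, p.2).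
Proof.
apply: eq_from_tnth => l; rewrite tnth_mktuple.
case: (unliftP ord0 l) => [m|] ->.
  by rewrite !tnth_tuple_of_pairS.
rewrite eqxx !tnth_tuple_of_pair0 /=; congr (_ - _ - _).
rewrite big_mkcond big_ord_recl/= add0r.
by apply: eq_bigr => m _; rewrite tnth_tuple_of_pairS.
Qed.

Lemma reflect_coordS d (k : 'I_d) c (b : 'I_d.+1 -> R) (p : R * d.-tuple R) :
  reflect_coord (lift ord0 k) c b (tuple_of_pair p) =
  tuple_of_pair
    (p.1, reflect_coord k (c - b ord0 * p.1) (b \o lift ord0) p.2).
Proof.
apply: eq_from_tnth => l; rewrite tnth_mktuple.
case: (unliftP ord0 l) => [m|] ->; last by [].
rewrite !tnth_tuple_of_pairS /= tnth_mktuple (inj_eq lift_inj).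
case: eqP => // _; congr (_ - _).
rewrite big_mkcond big_ord_recl/= tnth_tuple_of_pair0 opprD addrA.
congr (_ - _); rewrite -big_mkcond/=.
by apply: eq_big => i; rewrite ?(inj_eq lift_inj)// tnth_tuple_of_pairS.
Qed.

Lemma lebesgue_tupleS d (A : set (d.+1.-tuple R)) :
  lebesgue_tuple d.+1 A =
  (lebesgue_measure \x lebesgue_tuple d)%E (@tuple_of_pair R d @^-1` A).
Proof. by []. Qed.

(** Induction on [d] by sections. If [k] is the head, fixing the tail leaves a reflection of the
    real line. Otherwise, fixing the head [x] leaves a reflection of the tail whose constant is
    [c - b ord0 * x], hence the generality in [c]. *)
Lemma lebesgue_tuple_reflect d (k : 'I_d) c (b : 'I_d -> R)
    (A : set (d.-tuple R)) : measurable A ->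
  lebesgue_tuple d (reflect_coord k c b @^-1` A) = lebesgue_tuple d A.
Proof.
elim: d k c b A => [[]//|d IH] k c b A mA.
rewrite !lebesgue_tupleS.
have mT := @measurable_tuple_of_pair R d.
have mA' : measurable (@tuple_of_pair R d @^-1` A).
  by rewrite -[X in measurable X]setTI; exact: mT.
have mB : measurable (reflect_coord k c b @^-1` A).
  by rewrite -[X in measurable X]setTI; exact: measurable_reflect_coord.
have mB' : measurable (@tuple_of_pair R d @^-1` (reflect_coord k c b @^-1` A)).
  by rewrite -[X in measurable X]setTI; exact: mT.
case: (unliftP ord0 k) => [m kE|kE]; last first.
  (* [\x] integrates the measures of the tail sections over the head; reflecting the head with the
     tail fixed calls for the opposite order [\x^]. *)
  have swap X : measurable X ->
      (lebesgue_measure \x lebesgue_tuple d)%E X =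
      (lebesgue_measure \x^ lebesgue_tuple d)%E X :> \bar R.
    move=> mX; apply: product_measure_unique => // B C mB1 mC1.
    by rewrite /= product_measure2E.
  rewrite (swap _ mA') (swap _ mB'); apply: eq_integral => t _ /=.
  rewrite -[RHS](lebesgue_measure_reflect
    (c - \sum_l b (lift ord0 l) * tnth t l)); last exact: measurable_ysection.
  congr lebesgue_measure; apply/funext => x.
  by rewrite !ysectionE /preimage /mkset kE reflect_coord0.
apply: eq_integral => x _ /=.
rewrite -[RHS](IH m (c - b ord0 * x) (b \o lift ord0)); last first.
  exact: measurable_xsection.
congr (lebesgue_tuple d); apply/funext => t.
by rewrite !xsectionE /preimage /mkset kE reflect_coordS.
Qed.

Lemma measurable_box d (lo hi : 'I_d -> R) :
  measurable [set t : d.-tuple R | forall l, lo l <= tnth t l <= hi l].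
Proof.
rewrite (_ : [set t | _] = \bigcap_(l in [set: 'I_d])
    ((@tnth d R)^~ l @^-1` `[lo l, hi l])); last first.
  apply/seteqP; split => t /= H l; last by have := H l I; rewrite /= in_itv.
  by move=> _; rewrite /= in_itv/=; exact: H.
apply: fin_bigcap_measurable; first exact: finite_finset.
by move=> l _; rewrite -[X in measurable X]setTI; exact: measurable_tnth.
Qed.

(** Serves twice: an enclosing box will show that the simplex has finite measure, an inscribed one
    that its measure is positive. *)
Lemma lebesgue_tuple_box d (lo hi : 'I_d -> R) : (forall l, lo l < hi l) ->
  (0 < lebesgue_tuple d
    [set t : d.-tuple R | forall l, (lo l <= tnth t l <= hi l)%R] < +oo)%E.
Proof.
elim: d lo hi => [|d IH] lo hi lohi.
  rewrite (_ : [set t | _] = setT); last by apply/seteqP; split => t // _ [].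
  by rewrite /= diracT lte01 ltry.
rewrite lebesgue_tupleS.
rewrite (_ : _ @^-1` _ = `[lo ord0, hi ord0]%classic `*`
  [set t : d.-tuple R | forall l,
    lo (lift ord0 l) <= tnth t l <= hi (lift ord0 l)]); last first.
  apply/seteqP; split => -[x t] /=; rewrite in_itv/=.
    move=> H; split; first exact: (H ord0).
    by move=> l; rewrite -(tnth_tuple_of_pairS (x, t)); exact: H.
  move=> [xI H] l; case: (unliftP ord0 l) => [m|] -> //.
  by rewrite tnth_tuple_of_pairS.
rewrite product_measure1E//; last exact: measurable_box.
have /andP[t0 too] := IH (lo \o lift ord0) (hi \o lift ord0)
  (fun l => lohi _).
have e : (lebesgue_measure `[lo ord0, hi ord0] = (hi ord0 - lo ord0)%:E)%E.
  by rewrite lebesgue_measure_itv/= lte_fin lohi EFinB.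
rewrite [X in (X * _)%E]e; apply/andP; split.
  by apply: mule_gt0 => //; rewrite lte_fin subr_gt0.
by apply: lte_mul_pinfty => //; rewrite lee_fin subr_ge0 ltW.
Qed.

End reflect_coordinate.

(** The part of [V] that [phi] keeps in [V] contributes 0, since [h] is odd under [phi]; on the rest
    of [V] the last hypothesis forces [h] to be nonnegative. The condition on [phi (phi x)] concerns
    membership in [V] only, so [phi] need not be shown to be an involution. *)
Lemma Rintegral_antisym_ge0 d (T : measurableType d) (R : realType)
    (mu : {measure set T -> \bar R}) (V : set T) (h : T -> R) (phi : T -> T) :
  measurable_fun [set: T] phi ->
  (forall A, measurable A -> mu (phi @^-1` A) = mu A) ->
  measurable V -> measurable_fun [set: T] h ->
  mu.-integrable V (EFin \o h) ->
  (forall x, V (phi (phi x)) <-> V x) ->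
  (forall x, h (phi x) = - h x) ->
  (forall x, V x -> h x < 0 -> V (phi x)) ->
  0 <= \int[mu]_(x in V) h x.
Proof.
move=> mphi phimu mV mh ih VV hN hV.
have mphiV : measurable (phi @^-1` V).
  by rewrite -[X in measurable X]setTI; exact: mphi.
set W := V `&` phi @^-1` V.
have mW : measurable W by exact: measurableI.
have WE : phi @^-1` W = W.
  by apply/seteqP; split => x [] /= ? ?; split=> //=; apply/VV.
have ihW : mu.-integrable W (EFin \o h).
  by apply: integrableS ih => //; exact: subIsetl.
have ihW' : mu.-integrable (phi @^-1` W) ((EFin \o h) \o phi).
  rewrite WE (_ : _ \o phi = fun x => (- (h x)%:E)%E); first exact: integrableN.
  by apply/funext => x /=; rewrite hN.
(* Change of variables along [phi], which preserves both [mu] and [W] and changes the sign of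
   [h]. *)
have IW : \int[mu]_(x in W) h x = - \int[mu]_(x in W) h x.
  rewrite -[RHS]mulN1r -RintegralZl// {1}/Rintegral /Rintegral; congr fine.
  transitivity (\int[pushforward mu phi]_(x in W) (h x)%:E)%E.
    by apply: eq_measure_integral => A mA _; rewrite /= /pushforward phimu.
  rewrite (@integral_pushforward _ _ _ _ _ _ mphi _ _ (EFin \o h))//;
    last exact/measurable_EFinP.
  by rewrite WE; apply: eq_integral => x _ /=; rewrite hN mulN1r.
have VE : V = W `|` (V `\` phi @^-1` V) by rewrite setUIDK.
have mD : measurable (V `\` phi @^-1` V) by exact: measurableD.
rewrite {1}VE Rintegral_setU//; last 2 first.
- by rewrite -VE.
- by apply/disj_setPS => x [[_ ?] [_ ?]].
have -> : \int[mu]_(x in W) h x = 0 by lra.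
rewrite add0r; apply: Rintegral_ge0 => x [Vx nVx].
by rewrite leNgt; apply/negP => /hV - /(_ Vx).
Qed.

(** * Weighted coordinates on the polytope and their exchange *)

Section weighted_simplex.
Context {R : realType} (d : nat) (a : 'I_d -> R) (w : R).
Implicit Types (t : d.-tuple R) (k : 'I_d) (l i j : 'I_d.+1).

(** These are the x_i, shifted: index 0 is x_2, the slack in the total [w], and [lift ord0 k] is
    x_(k+3). *)
Definition bary t l : R :=
  if unlift ord0 l is Some k then a k * tnth t k
  else w - \sum_k a k * tnth t k.

Lemma bary0 t : bary t ord0 = w - \sum_k a k * tnth t k.
Proof. by rewrite /bary unlift_none. Qed.

Lemma baryS t k : bary t (lift ord0 k) = a k * tnth t k.
Proof. by rewrite /bary liftK. Qed.

Lemma sum_bary t : \sum_l bary t l = w.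
Proof.
rewrite big_ord_recl bary0 -[RHS](subrK (\sum_k a k * tnth t k)); congr (_ + _).
by apply: eq_bigr => k _; rewrite baryS.
Qed.

Lemma measurable_bary l : measurable_fun [set: d.-tuple R] (bary ^~ l).
Proof.
case: (unliftP ord0 l) => [k|] ->.
  under eq_fun do rewrite baryS.
  by apply: measurable_funM => //; exact: measurable_tnth.
under eq_fun do rewrite bary0.
by apply: measurable_funB => //; exact: measurable_linear_comb.
Qed.

(** Exchanging coordinate 0 with [lift ord0 k] means replacing t_k by (w - sum_m a_m t_m) / a_k,
    with all other t_m fixed. The summand m = k contributes -t_k, which makes this a reflection
    along axis [k]. *)
Definition bary_swap k : d.-tuple R -> d.-tuple R :=
  reflect_coord k (w / a k) (fun m => a m / a k).

Lemma bary_swapE k t l : a k != 0 ->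
  bary (bary_swap k t) l = bary t (tperm ord0 (lift ord0 k) l).
Proof.
move=> ak0; pose S := \sum_(m | m != k) a m * tnth t m.
have t0 : bary t ord0 = w - (a k * tnth t k + S) by rewrite bary0 (bigD1 k).
have tk : tnth (bary_swap k t) k = bary t ord0 / a k.
  rewrite tnth_mktuple eqxx /=.
  rewrite (_ : \sum_(m | m != k) a m / a k * tnth t m = S / a k).
    by rewrite t0; field.
  by rewrite mulr_suml; apply: eq_bigr => m _; rewrite mulrAC.
have tm m : m != k -> tnth (bary_swap k t) m = tnth t m.
  by move=> mk; rewrite tnth_mktuple (negbTE mk).
case: (unliftP ord0 l) => [m|] ->.
  have [->|mk] := eqVneq m k.
    by rewrite tpermR baryS tk; field.
  by rewrite tpermD ?(inj_eq lift_inj) 1?eq_sym// !baryS tm.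
rewrite tpermL baryS bary0 (bigD1 k)//= tk.
rewrite (eq_bigr (fun m => a m * tnth t m)); last by move=> m mk; rewrite tm.
by rewrite -/S t0; field.
Qed.

Hypothesis a0 : forall k, 0 < a k.

(* A transposition of two coordinates other than the 0-th is conjugate to one
   that involves the 0-th, which in the s_k is a reflection along one axis. *)
Lemma bary_tperm i j : (i < j)%N ->
  exists phi : d.-tuple R -> d.-tuple R, [/\ measurable_fun setT phi,
    forall A, measurable A ->
      lebesgue_tuple d (phi @^-1` A) = lebesgue_tuple d A &
    forall t l, bary (phi t) l = bary t (tperm i j l)].
Proof.
have ms k : measurable_fun setT (bary_swap k).
  exact: measurable_reflect_coord.
have mA k A : measurable A -> measurable (bary_swap k @^-1` A).
  by move=> mA; rewrite -[X in measurable X]setTI; exact: ms.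
have ls k A : measurable A ->
    lebesgue_tuple d (bary_swap k @^-1` A) = lebesgue_tuple d A.
  exact: lebesgue_tuple_reflect.
have bs k t l : bary (bary_swap k t) l = bary t (tperm ord0 (lift ord0 k) l).
  by rewrite bary_swapE// gt_eqF.
case: (unliftP ord0 j) => [k' ->|->]; last by [].
case: (unliftP ord0 i) => [k -> kk'|-> _]; last first.
  by exists (bary_swap k'); split; [exact: ms|exact: ls|exact: bs].
exists (bary_swap k \o (bary_swap k' \o bary_swap k)); split.
- by apply: measurableT_comp => //; exact: measurableT_comp.
- move=> A mA'; rewrite !comp_preimage.
  rewrite ls; last exact: (mA _ _ (mA _ _ mA')).
  by rewrite ls; [exact: ls|exact: (mA _ _ mA')].
move=> t l; rewrite /= !bs -!permM; congr (bary t _); congr (fun_of_perm _ l).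
(* A transposition is its own inverse, so the triple product is a conjugate, and [tpermJ] applies
   the conjugating transposition to both indices. *)
rewrite mulgA -{1}[tperm ord0 (lift ord0 k)]tpermV -mulgA -/(conjg _ _) tpermJ.
rewrite tpermL tpermD// (inj_eq lift_inj).
by apply: contraTneq kk' => ->; rewrite ltnn.
Qed.

Variables (g : 'I_d.+1 -> R) (v : R).

(** In these coordinates the first inequality of the polytope becomes nonnegativity of coordinate 0,
    and the second becomes the bound on the [g]-weighted sum. *)
Definition weighted_simplex : set (d.-tuple R) :=
  [set t | (forall l, 0 <= bary t l) /\ \sum_l g l * bary t l <= v].

Local Notation V := weighted_simplex.

Lemma measurable_weighted_simplex : measurable V.
Proof.
rewrite (_ : V = \bigcap_(l in [set: 'I_d.+1]) (bary ^~ l @^-1` `[0, +oo[)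
    `&` (fun t => \sum_l g l * bary t l) @^-1` `]-oo, v]).
  apply: measurableI.
    apply: fin_bigcap_measurable; first exact: finite_finset.
    by move=> l _; rewrite -[X in measurable X]setTI; exact: measurable_bary.
  rewrite -[X in measurable X]setTI.
  have : measurable_fun setT (fun t => \sum_l g l * bary t l).
    apply: measurable_sum => l.
    by apply: measurable_funM => //; exact: measurable_bary.
  exact.
apply/seteqP; split => t /= [H1 H2]; split.
- by move=> l _; rewrite /= in_itv/= H1.
- by rewrite in_itv.
- by move=> l; have := H1 l I; rewrite /= in_itv/= andbT.
- by move: H2; rewrite in_itv.
Qed.

Lemma bary_le t l : V t -> bary t l <= w.
Proof.
by move=> [t0 _]; rewrite -(sum_bary t) (bigD1 l)//= lerDl sumr_ge0.
Qed.

(** Nonnegative coordinates with sum [w] are each at most [w], so [V] lies in the box with sides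
    [w / a k]. *)
Lemma lebesgue_weighted_simplex_lty : 0 < w -> (lebesgue_tuple d V < +oo)%E.
Proof.
move=> w0.
have h k : 0 < w / a k by rewrite divr_gt0.
have /andP[_] := @lebesgue_tuple_box _ d (fun=> 0) (fun k => w / a k) h.
apply: le_lt_trans; apply: le_measure; rewrite ?inE.
- exact: measurable_weighted_simplex.
- exact: measurable_box.
move=> t Vt k; have := bary_le (lift ord0 k) Vt; case: Vt => /(_ (lift ord0 k)).
by rewrite baryS pmulr_rge0// => -> _; rewrite ler_pdivlMr// mulrC.
Qed.

Lemma integrable_bary l : 0 < w ->
  (lebesgue_tuple d).-integrable V (EFin \o bary ^~ l).
Proof.
move=> w0; apply: measurable_bounded_integrable.
- exact: measurable_weighted_simplex.
- exact: lebesgue_weighted_simplex_lty.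
- by apply: measurable_funTS; exact: measurable_bary.
exists w; split; first exact: num_real.
move=> M wM t Vt; have [/(_ l) t0 _] := Vt.
by rewrite /= ger0_norm//; exact: le_trans (bary_le l Vt) (ltW wM).
Qed.

(** At the vertex where coordinate [lift ord0 k0] carries all of [w], the weighted sum is strictly
    below [v]; a small box near this vertex therefore fits into [V]. *)
Lemma lebesgue_weighted_simplex_gt0 k0 : 0 < w ->
  (forall l, 0 < g l <= g ord0) -> g (lift ord0 k0) * w < v ->
  (0 < lebesgue_tuple d V)%E.
Proof.
move=> w0 g0 gv.
set gm := g (lift ord0 k0) in gv.
have g00 : 0 < g ord0 by have /andP[] := g0 ord0.
have gm0 : 0 < gm by have /andP[] := g0 (lift ord0 k0).
(* At most [2 * r] will be moved away from the vertex: the first bound keeps coordinate [k0]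
   nonnegative, the second keeps the added weight, at most [g ord0] per unit, within
   [v - gm * w]. *)
pose r := Num.min w ((v - gm * w) / g ord0) / 2.
have r0 : 0 < r.
  by rewrite divr_gt0// lt_min w0/= divr_gt0// subr_gt0.
have rw : 2 * r <= w by rewrite mulrC divfK// ge_min lexx.
have rv : g ord0 * (2 * r) <= v - gm * w.
  by rewrite (mulrC 2) divfK// mulrC -ler_pdivlMr// ge_min lexx orbT.
have d0 : (0 < d)%N by apply: leq_ltn_trans (ltn_ord k0).
have d0' : 0 < d%:R :> R by rewrite ltr0n.
(* Coordinate [k0] leaves at least [r] of the total, and the others among the [d] use at most [r]
   together, so the slack coordinate 0 is nonnegative. *)
pose lo k : R := if k == k0 then (w - 2 * r) / a k else 0.
pose hi k : R := if k == k0 then (w - r) / a k else r / d%:R / a k.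
have lohi k : lo k < hi k.
  rewrite /lo /hi; case: eqP => _; last first.
    by apply: divr_gt0 => //; exact: divr_gt0.
  by rewrite ltr_pM2r ?invr_gt0//; lra.
have /andP[B0 _] := lebesgue_tuple_box lohi.
apply: lt_le_trans B0 _; apply: le_measure; rewrite ?inE.
- exact: measurable_box.
- exact: measurable_weighted_simplex.
move=> t Bt.
have bk k : k != k0 -> 0 <= bary t (lift ord0 k) <= r / d%:R.
  move=> kk0; have := Bt k; rewrite /lo /hi (negbTE kk0) baryS.
  by rewrite (ler_pdivlMr _ _ (a0 k)) (mulrC (tnth t k)) pmulr_rge0.
have bk0 : w - 2 * r <= bary t (lift ord0 k0) <= w - r.
  have := Bt k0; rewrite /lo /hi eqxx baryS.
  by rewrite ler_pdivrMr// ler_pdivlMr// (mulrC (tnth t k0)).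
have b0 : 0 <= bary t ord0.
  rewrite bary0 (bigD1 k0)//= -baryS.
  have : \sum_(k | k != k0) a k * tnth t k <= r.
    apply: (@le_trans _ _ (\sum_(k : 'I_d) r / d%:R)).
      rewrite big_mkcond; apply: ler_sum => k _.
      case: ifPn => [/bk|_]; first by rewrite baryS => /andP[].
      by rewrite divr_ge0// ltW.
    by rewrite sumr_const card_ord -[_ *+ d]mulr_natr divfK// gt_eqF.
  by case/andP: bk0; lra.
have bge0 l : 0 <= bary t l.
  case: (unliftP ord0 l) => [k|] -> //.
  have [->|/bk/andP[]//] := eqVneq k k0.
  by case/andP: bk0; lra.
split=> //; rewrite (bigD1 (lift ord0 k0))//= -/gm.
have : \sum_(l | l != lift ord0 k0) g l * bary t l <=
       g ord0 * (w - bary t (lift ord0 k0)).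
  rewrite -(sum_bary t) [X in _ <= _ * (X - _)](bigD1 (lift ord0 k0))//=.
  rewrite addrAC subrr add0r mulr_sumr; apply: ler_sum => l _.
  by rewrite ler_wpM2r//; have /andP[] := g0 l.
case/andP: bk0 => h1 h2.
have : g ord0 * (w - bary t (lift ord0 k0)) <= g ord0 * (2 * r).
  by rewrite ler_pM2l//; lra.
have : gm * bary t (lift ord0 k0) <= gm * w by rewrite ler_pM2l//; lra.
lra.
Qed.

Lemma Rintegral_bary_le i j : (i <= j)%N -> g j <= g i -> 0 < w ->
  \int[lebesgue_tuple d]_(t in V) bary t i <=
  \int[lebesgue_tuple d]_(t in V) bary t j.
Proof.
rewrite leq_eqVlt => /predU1P[/val_inj->//|ij] gji w0.
have mV := measurable_weighted_simplex.
rewrite -subr_ge0 -RintegralB//; [|exact: integrable_bary..].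
have [phi [mphi lphi bphi]] := bary_tperm ij.
apply: (Rintegral_antisym_ge0 mphi lphi mV).
- by apply: measurable_funB; exact: measurable_bary.
- rewrite (_ : _ \o _ = (EFin \o bary ^~ j) \- (EFin \o bary ^~ i))%E//.
  by apply: integrableB => //; exact: integrable_bary.
- move=> t; rewrite /V /=.
  suff -> : bary (phi (phi t)) = bary t by [].
  by apply/funext => l; rewrite !bphi tpermK.
- by move=> t; rewrite !bphi tpermL tpermR opprB.
move=> t [t0 tv]; rewrite subr_lt0 => tij; split.
  by move=> l; rewrite bphi.
apply: le_trans tv.
have ji : j != i by apply: contraTneq ij => ->; rewrite ltnn.
(* Only the terms [i] and [j] change: the exchange lowers the weighted sum by (g_i - g_j)(x_i -
   x_j), a product of nonnegative factors. *)
rewrite (bigD1 i)//= (bigD1 j)//= [leRHS](bigD1 i)//= [in leRHS](bigD1 j)//=.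
rewrite !bphi tpermL tpermR.
rewrite (eq_bigr (fun l => g l * bary t l)); last first.
  by move=> l /andP[li lj]; rewrite bphi tpermD 1?eq_sym.
rewrite !addrA lerD2r; nra.
Qed.

End weighted_simplex.

(** * Means of the weighted coordinates *)

Lemma Rintegral_sum d (T : measurableType d) (R : realType)
    (mu : {measure set T -> \bar R}) (D : set T) (I : Type) (s : seq I)
    (f : I -> T -> R) : measurable D ->
  (forall i, mu.-integrable D (EFin \o f i)) ->
  \int[mu]_(x in D) (\sum_(i <- s) f i x) =
  \sum_(i <- s) \int[mu]_(x in D) f i x.
Proof.
move=> mD fi; rewrite /Rintegral.
under eq_integral do rewrite -sumEFin.
rewrite integral_sum// sum_fine// => i _.
exact: (integrable_fin_num mD (fi i)).
Qed.

Section weighted_simplex_mean.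
Context {R : realType} (d : nat) (a : 'I_d -> R) (w : R).
Variables (g : 'I_d.+1 -> R) (v : R).
Hypotheses (a0 : forall k, 0 < a k) (w0 : 0 < w).
Hypothesis V0 : (0 < lebesgue_tuple d (weighted_simplex a w g v))%E.

Local Notation V := (weighted_simplex a w g v).
Local Notation mean l := (lebesgue_mean V (fun t => bary a w t l)).

Let fineV0 : 0 < fine (lebesgue_tuple d V).
Proof. by apply: fine_gt0; rewrite V0 lebesgue_weighted_simplex_lty. Qed.

Lemma bary_mean_ge0 l : 0 <= mean l.
Proof.
apply: divr_ge0; last exact: ltW.
by apply: Rintegral_ge0 => t [/(_ l)].
Qed.

Lemma bary_mean_le (i j : 'I_d.+1) : (i <= j)%N -> g j <= g i ->
  mean i <= mean j.
Proof.
move=> ij gji; apply: ler_wpM2r; first by rewrite invr_ge0 ltW.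
exact: Rintegral_bary_le.
Qed.

Lemma sum_bary_mean : \sum_l mean l = w.
Proof.
rewrite -mulr_suml -Rintegral_sum.
- under eq_Rintegral do rewrite sum_bary.
  rewrite Rintegral_cst; last exact: measurable_weighted_simplex.
  by rewrite mulfK// gt_eqF.
- exact: measurable_weighted_simplex.
- by move=> l; exact: integrable_bary.
Qed.

(** Passes from the means of the plain coordinates s_i, which define the q_i, to those of the
    weighted ones. *)
Lemma tnth_mean k :
  a k * lebesgue_mean V (fun t => tnth t k) = mean (lift ord0 k).
Proof.
rewrite /lebesgue_mean mulrA; congr (_ / _).
rewrite (_ : \int[_]_(t in V) tnth t k =
    \int[lebesgue_tuple d]_(t in V) ((a k)^-1 * bary a w t (lift ord0 k))).
  rewrite RintegralZl; last exact: integrable_bary; last first.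
    exact: measurable_weighted_simplex.
  by rewrite mulrA mulfV ?mul1r// gt_eqF.
by apply: eq_Rintegral => t _; rewrite baryS mulKf// gt_eqF.
Qed.

End weighted_simplex_mean.

(** * The functions q_i in the interior of the cone *)

Section qhat.
Context {R : realType} (n : nat) (mu : nat -> R).
Hypothesis n4 : (4 <= n)%N.
Hypothesis mu1 : mu 1%N = 1.
Hypothesis mu_incr : forall i j : nat,
  (1 <= i)%N -> (i < j)%N -> (j <= n)%N -> mu i < mu j.

Local Notation wt i := (1 - (mu i)^-1).
(** An ordinal [k] in [a] stands for the index k + 3 of s_3, ..., s_n; an ordinal [l] in [g] stands
    for the index l + 2 of x_2, ..., x_n. *)
Let a (k : 'I_(n - 2)) : R := wt (k + 3).
Let g (l : 'I_(n - 2).+1) : R := (mu (l + 2) - 1)^-1.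

Let mu_gt1 i : (2 <= i <= n)%N -> 1 < mu i.
Proof. by move=> /andP[? ?]; rewrite -mu1; apply: mu_incr. Qed.

Let mu_gt1' i : (3 <= i <= n)%N -> 1 < mu i.
Proof. by move=> /andP[i3 iN]; rewrite mu_gt1// iN ltnW. Qed.

Let ord_ge3 (k : 'I_(n - 2)) : (3 <= k + 3 <= n)%N.
Proof. by rewrite leq_addl /=; have := ltn_ord k; lia. Qed.

Let ord_ge2 (l : 'I_(n - 2).+1) : (2 <= l + 2 <= n)%N.
Proof. by rewrite leq_addl /=; have := ltn_ord l; lia. Qed.

Let wt_gt0 i : (2 <= i <= n)%N -> 0 < wt i.
Proof.
move=> /mu_gt1 mui; rewrite subr_gt0 invf_lt1//.
exact: lt_trans mui.
Qed.

Let a0 k : 0 < a k.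
Proof.
by rewrite /a wt_gt0//; have /andP[? ->] := ord_ge3 k; rewrite andbT ltnW.
Qed.

Let g_le (i j : 'I_(n - 2).+1) : (i <= j)%N -> g j <= g i.
Proof.
move=> ij; have mui := mu_gt1 (ord_ge2 i); have muj := mu_gt1 (ord_ge2 j).
rewrite lef_pV2 ?posrE ?subr_gt0// lerD2r.
move: ij; rewrite leq_eqVlt => /predU1P[->//|ij].
apply/ltW/mu_incr; rewrite ?ltn_add2r//; last by have /andP[] := ord_ge2 j.
by rewrite addn2.
Qed.

Lemma big_nat3_ord (F : nat -> R) :
  \sum_(3 <= i < n.+1) F i = \sum_(k < n - 2) F (k + 3)%N.
Proof. by rewrite -[3%N]add0n big_addn subSS big_mkord. Qed.

Lemma polytopeE u v : polytope n mu u v = weighted_simplex a (u - v) g v.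
Proof.
have mu2 : 1 < mu 2%N by apply: mu_gt1; lia.
have mu_neq0 (k : 'I_(n - 2)) : mu (k + 3)%N != 0.
  by rewrite gt_eqF// (lt_trans ltr01)// (mu_gt1' (ord_ge3 k)).
have sk (s : (n - 2).-tuple R) (k : 'I_(n - 2)) : s`_(k + 3 - 3) = tnth s k.
  by rewrite addnK (tnth_nth 0).
have sumE (s : (n - 2).-tuple R) (c : R) :
    \sum_(3 <= i < n.+1) (1 - c / mu i) * s`_(i - 3) =
    \sum_k tnth s k - c * \sum_k tnth s k / mu (k + 3)%N.
  rewrite big_nat3_ord mulr_sumr -sumrB; apply: eq_bigr => k _.
  by rewrite sk; ring.
have sumaE (s : (n - 2).-tuple R) : \sum_k a k * tnth s k =
    \sum_k tnth s k - \sum_k tnth s k / mu (k + 3)%N.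
  by rewrite -sumrB; apply: eq_bigr => k _; rewrite /a; ring.
(* For i >= 3 the two weights combine to (1 - 1/mu_i) / (mu_i - 1) = 1/mu_i. *)
have sumgE (s : (n - 2).-tuple R) : \sum_l g l * bary a (u - v) s l =
    (mu 2%N - 1)^-1 * bary a (u - v) s ord0 + \sum_k tnth s k / mu (k + 3)%N.
  rewrite big_ord_recl; congr (_ + _); apply: eq_bigr => k _.
  rewrite baryS /g /a (_ : lift ord0 k + 2 = k + 3)%N; last first.
    by rewrite lift0 addSnnS.
  have ? : mu (k + 3)%N - 1 != 0.
    by rewrite gt_eqF// subr_gt0 (mu_gt1' (ord_ge3 k)).
  by field; apply/andP; split.
have mu20 : 0 < mu 2%N - 1 by rewrite subr_gt0.
(* With S the sum of the s_i and T that of the s_i / mu_i, multiplying by mu_2 - 1 > 0 gives u - v -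
   S + T <= (mu_2 - 1)(v - T), that is, u - mu_2 v <= S - mu_2 T. *)
have halfE (s : (n - 2).-tuple R) :
    (\sum_l g l * bary a (u - v) s l <= v) =
    (u - mu 2%N * v <= \sum_(3 <= i < n.+1) (1 - mu 2%N / mu i) * s`_(i - 3)).
  rewrite sumgE bary0 sumaE sumE -lerBrDr ler_pdivrMl//.
  by apply/idP/idP; lra.
apply/seteqP; split => s.
  move=> [s0 s1 s2]; split; last by rewrite halfE.
  move=> l; case: (unliftP ord0 l) => [k|] ->.
    by rewrite baryS mulr_ge0 ?(ltW (a0 k))// -sk s0.
  rewrite bary0 subr_ge0 sumaE.
  by move: s1; rewrite sumE mu1 !mul1r.
move=> [s0 s1]; split; last by rewrite -halfE.
  move=> i /andP[i3 iN]; have ik : (i - 3 < n - 2)%N by lia.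
  have := s0 (lift ord0 (Ordinal ik)).
  by rewrite baryS pmulr_rge0// (tnth_nth 0).
have := s0 ord0; rewrite bary0 subr_ge0 sumaE.
by rewrite sumE mu1 !mul1r.
Qed.

(** Each [wt i * q i u v] with 2 <= i <= n is the mean of weighted coordinate i - 2, so the facts on
    these means carry over. *)
Lemma qhat_interior q u v : is_qhat n mu q -> v < u < mu n * v ->
  [/\ 0 <= wt 2 * q 2%N u v,
    forall i j, (2 <= i)%N -> (i <= j)%N -> (j <= n)%N ->
      wt i * q i u v <= wt j * q j u v &
    \sum_(2 <= i < n.+1) wt i * q i u v = u - v].
Proof.
move=> qq uv; have /andP[vu unv] := uv.
have mun1 : 1 < mu n by apply: mu_gt1; lia.
have inC : (cone n mu)^° (u, v) by apply/interior_cone.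
have w0 : 0 < u - v by rewrite subr_gt0.
pose V := weighted_simplex a (u - v) g v.
(* The vertex chosen is that of x_n, where the strict inequality required is (u - v) / (mu_n - 1) <
   v, equivalent to u < mu_n v. *)
have V0 : (0 < lebesgue_tuple (n - 2) V)%E.
  have kn : (n - 3 < n - 2)%N by lia.
  apply: (@lebesgue_weighted_simplex_gt0 _ _ _ _ _ _ _ (Ordinal kn)) => //.
    move=> l; rewrite invr_gt0 subr_gt0 mu_gt1//=; exact: g_le.
  rewrite /g (_ : lift ord0 (Ordinal kn) + 2 = n)%N; last first.
    by rewrite /= /bump; lia.
  by rewrite mulrC ltr_pdivrMr ?subr_gt0//; lra.
pose mean l := lebesgue_mean V (fun t => bary a (u - v) t l).
have meanS (k : 'I_(n - 2)) : wt (k + 3) * q (k + 3)%N u v = mean (lift ord0 k).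
  rewrite /mean -(tnth_mean g v a0 w0); congr (_ * _).
  rewrite (qhat_mean qq inC (ord_ge3 k)) polytopeE addnK.
  by congr lebesgue_mean; apply/funext => s; rewrite (tnth_nth 0).
(* Difference of the two linear relations on the q_i; the term i = 1 vanishes because mu_1 = 1. *)
have sumw : \sum_(2 <= i < n.+1) wt i * q i u v = u - v.
  have n1 : (1 < n.+1)%N by lia.
  transitivity (\sum_(1 <= i < n.+1) q i u v -
      \sum_(1 <= i < n.+1) (mu i)^-1 * q i u v); last first.
    by rewrite (qhat_sum qq inC) (qhat_sumV qq inC).
  rewrite -sumrB (big_ltn n1) mu1 invr1 mul1r subrr add0r.
  by apply: eq_bigr => i _; rewrite mulrBl mul1r.
(* q_2 is given only through the linear relations: both families sum to u - v and agree for i >= 3,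
   hence also at i = 2. *)
have mean0 : wt 2 * q 2%N u v = mean ord0.
  apply: (@addIr _ (\sum_(k < n - 2) mean (lift ord0 k))).
  rewrite -big_ord_recl [RHS](sum_bary_mean a0 w0 V0) -[RHS]sumw.
  rewrite big_ltn; last by lia.
  by rewrite big_nat3_ord; congr (_ + _); apply: eq_bigr => k _; rewrite meanS.
have meanE (l : 'I_(n - 2).+1) : wt (l + 2) * q (l + 2)%N u v = mean l.
  case: (unliftP ord0 l) => [k|] -> //.
  by rewrite (_ : lift ord0 k + 2 = k + 3)%N// lift0 addSnnS.
have ordE i : (2 <= i <= n)%N -> exists l : 'I_(n - 2).+1, i = (l + 2)%N.
  move=> /andP[i2 iN]; have il : (i - 2 < (n - 2).+1)%N by lia.
  by exists (Ordinal il); rewrite subnK.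
split=> //.
  by rewrite mean0; exact: bary_mean_ge0.
move=> i j i2 ij jn.
have [l lE] : exists l : 'I_(n - 2).+1, i = (l + 2)%N.
  by apply: ordE; rewrite i2 (leq_trans ij).
have [m mE] : exists m : 'I_(n - 2).+1, j = (m + 2)%N.
  by apply: ordE; rewrite jn andbT (leq_trans i2).
have lm : (l <= m)%N by rewrite -(leq_add2r 2) -lE -mE.
by rewrite lE mE !meanE; apply: bary_mean_le => //; exact: g_le.
Qed.

End qhat.

(** * Extension to the boundary rays and the upper bound *)

Theorem theorem2p3 (R : realType) (n : nat) (mu : nat -> R)
    (q : nat -> R -> R -> R)
    (n_ge4 : (4 <= n)%N)
    (mu1 : mu 1%N = 1)
    (mu_incr : forall i j : nat,
      (1 <= i)%N -> (i < j)%N -> (j <= n)%N -> mu i < mu j)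
    (q_qhat : is_qhat n mu q) :
  (forall u v : R, cone n mu (u, v) ->
     forall i j : nat, (2 <= i)%N -> (i <= j)%N -> (j <= n)%N ->
       (1 - (mu i)^-1) * q i u v <= (1 - (mu j)^-1) * q j u v) /\
  (forall i : nat, (2 <= i)%N -> (i <= n)%N ->
     forall u v : R, cone n mu (u, v) ->
       q i u v <= ((n - i + 1)%:R * (1 - (mu i)^-1))^-1 * (u - v)).
Proof.
have wt_gt0 i : (2 <= i <= n)%N -> 0 < 1 - (mu i)^-1.
  move=> /andP[i2 iN]; have mui : 1 < mu i by rewrite -mu1 mu_incr.
  by rewrite subr_gt0 invf_lt1// (lt_trans ltr01).
have key u v : cone n mu (u, v) ->
  [/\ 0 <= (1 - (mu 2%N)^-1) * q 2%N u v,
    forall i j, (2 <= i)%N -> (i <= j)%N -> (j <= n)%N ->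
      (1 - (mu i)^-1) * q i u v <= (1 - (mu j)^-1) * q j u v &
    \sum_(2 <= i < n.+1) (1 - (mu i)^-1) * q i u v = u - v].
  move=> [/= v0 vu unv]; have u0 := le_trans v0 vu.
  (* On the diagonal ray all q_i with i >= 2 vanish, and so does u - v; the apex of the cone falls
     under this case. *)
  have [vuE|vuN] := eqVneq v u.
    have q0 i : (2 <= i <= n)%N -> q i u v = 0.
      by move=> iN; rewrite vuE (qhat_diag0 q_qhat).
    split.
    - by rewrite q0 ?mulr0//; lia.
    - by move=> i j i2 ij jn; rewrite !q0 ?mulr0//; lia.
    - rewrite big_nat big1 => [|i iN]; first by rewrite vuE subrr.
      by rewrite q0 ?mulr0//; lia.
  (* On the other ray only q_n = u survives, and (1 - 1/mu_n) u = u - v. *)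
  have [uE|uN] := eqVneq u (mu n * v).
    have mun0 : 0 < mu n.
      by rewrite (@lt_trans _ _ 1)// -mu1; apply: mu_incr => //; lia.
    have vE : v = u / mu n by rewrite uE mulrC mulKf// gt_eqF.
    have q0 i : (2 <= i < n)%N -> q i u v = 0.
      by move=> iN; rewrite vE (qhat_last0 q_qhat)//; lia.
    have qn : q n u v = u by rewrite vE (qhat_last q_qhat).
    split.
    - by rewrite q0 ?mulr0//; lia.
    - move=> i j i2 ij jn; have [->//|ijN] := eqVneq i j.
      rewrite q0 ?mulr0; last lia.
      have [->|jN] := eqVneq j n; last by rewrite q0 ?mulr0//; lia.
      by rewrite qn mulr_ge0// ltW// wt_gt0//; lia.
    - rewrite big_nat_recr/=; last lia.
      rewrite qn big_nat big1 ?add0r; last by move=> i iN; rewrite q0 ?mulr0.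
      by rewrite vE; ring.
  by apply: qhat_interior => //; rewrite !lt_neqAle vuN uN vu unv.
split=> [u v /key[]//|i i2 iN u v /key[q2 qle qsum]].
have wi : 0 < 1 - (mu i)^-1 by rewrite wt_gt0// i2.
have m0 : 0 < (n - i + 1)%:R :> R by rewrite ltr0n addn1.
rewrite mulrC ler_pdivlMr ?mulr_gt0// mulrCA (mulrC (q i u v)).
(* The terms before [i] dominate the nonnegative term 2; each of the n - i + 1 terms from [i] on is
   at least the [i]-th. *)
rewrite -qsum (@big_cat_nat _ _ _ i)/=; [|lia|lia].
rewrite -[leLHS]add0r lerD//.
  rewrite big_nat sumr_ge0// => j /andP[j2 ji].
  by apply: le_trans q2 (qle _ _ _ _ _) => //; lia.
rewrite mulr_natl addn1 -subSn// -sumr_const_nat.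
by apply: ler_sum_nat => j /andP[ij jn]; exact: qle.
Qed.
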